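(* Let $s\ge 1$, $k\ge 2$ and $d\ge k(2s+1)+1$ be integers. Let $\mathbf{j}=[1,\dots,1]\in\mathbb{R}^d$ and $$D_{s,k}^{d}=\Big\{\, [1^{s},0^{d-s}]-\tfrac{s-1}{d-2k}\mathbf{j}\,\Big\}\cup\Big\{\,[1^{s+1},0^{d-s-1}]-\tfrac{s}{d-2k}\mathbf{j}\,\Big\},$$ with all permutations of coordinates of $[1^s,0^{d-s}]$ and $[1^{s+1},0^{d-s-1}]$ taken, and $P_{s,k}^{d}=\tfrac12\mathrm{conv}\big(D_{s,k}^{d}\cup(-D_{s,k}^{d})\big)$. Then there is at most one positive definite quadratic form $\phi$ on $\mathbb{R}^d$ such that, for some $\mathbf{c}\in\mathbb{R}^d$, the ellipsoid $\{\mathbf{x}:\phi(\mathbf{x}-\mathbf{c})=1\}$ passes through all vertices of $P_{s,k}^d$.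
   Context: $[1^a,0^b]$ denotes the vector with $a$ entries $1$ followed by $b$ entries $0$. *)

(* Defs.v *)
From mathcomp Require Import all_boot all_order all_fingroup all_algebra.
From mathcomp Require Import all_classical reals convex.

Set Implicit Arguments.
Unset Strict Implicit.
Unset Printing Implicit Defensive.

Import Order.TTheory GRing.Theory Num.Theory.
Local Open Scope classical_set_scope.
Local Open Scope ring_scope.

Section Polytopes.
Context {R : realType} {d : nat}.

Definition conv_hull (A : set 'rV[R]_d) : set 'rV[R]_d :=
  smallest (@convex_set R 'rV[R]_d) A.

(* The vertices of a polytope are its extreme points. *)
Definition vertices (P : set 'rV[R]_d) : set 'rV[R]_d :=
  [set v | P v /\ forall (x y : 'rV[R]_d) (t : R), P x -> P y ->
     0 < t -> t < 1 -> v = t *: x + (1 - t) *: y -> x = v /\ y = v].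

Definition quadratic_form (phi : 'rV[R]_d -> R) : Prop :=
  exists b : {symmetric 'rV[R]_d}, forall x, phi x = b x x.

Definition positive_definite (phi : 'rV[R]_d -> R) : Prop :=
  forall x, x != 0 -> 0 < phi x.

Definition ellipsoid (phi : 'rV[R]_d -> R) (c : 'rV[R]_d) : set 'rV[R]_d :=
  [set x | phi (x - c) = 1].

End Polytopes.

Definition ones (R : realType) (d a : nat) : 'rV[R]_d := \row_(i < d) (i < a)%:R.

(* [col_perm p v] is [v] with its coordinates permuted by [p].  The scalar
   coefficients are computed in [R], so no subtraction is truncated. *)
Definition D_set (R : realType) (s k d : nat) : set 'rV[R]_d :=
  [set col_perm p (ones R d s)
         - ((s%:R - 1) / (d%:R - 2 * k%:R)) *: const_mx 1 | p in [set: 'S_d]]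
  `|` [set col_perm p (ones R d s.+1)
         - (s%:R / (d%:R - 2 * k%:R)) *: const_mx 1 | p in [set: 'S_d]].
Arguments D_set : clear implicits.

Definition P_set (R : realType) (s k d : nat) : set 'rV[R]_d :=
  [set 2^-1 *: x | x in
     conv_hull (D_set R s k d `|` [set - x | x in D_set R s k d])].
Arguments P_set : clear implicits.

(* Main.v *)
(* Write g = 1/(d - 2k) and, for a set S of coordinates, let p_S be the indicator
   of S minus (|S| - 1) g j; then D is the set of all p_S with |S| = s or s + 1.
   Each p_S is the unique maximiser over D and -D of a functional
   x |-> sum_(i in S) x_i - t sum_i x_i, so all points of D and -D give vertices.
   Since they come in antipodal pairs, the centre of an ellipsoid through them is
   orthogonal to D, hence to all vectors, and the difference b of two admissible
   forms vanishes at every p_S.  Exchanging one coordinate a of S for c shows that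
   b(e_a - e_c, e_i) takes the same value g b(e_a - e_c, j) for all i other than
   a, c and that b(e_a, e_a) = b(e_c, e_c); summing over i and using k <> 1, this
   value is 0.
   So b = u (sum x_i)^2 + v sum x_i^2, and the two equations |S| = s, s + 1 for
   (u, v) have determinant g^2 (d(d-2s-1) - 4k(k-1)s(s+1)) > 0. *)
From HB Require Import structures.
Require Import Defs.
From mathcomp Require Import all_boot all_order all_fingroup all_algebra.
From mathcomp Require Import all_classical reals convex.
From mathcomp Require Import interval_inference ring lra zify.

Local Open Scope ring_scope.
Import Order.TTheory GRing.Theory Num.Theory.

(** * Extreme points of convex hulls *)

(** The set of x with x = v or l x < l v is convex and contains A, hence contains the hull. A proper
    convex combination of two of its points has l-value below l v unless both points are v. *)
Lemma vertex_of_strict_max (R : realType) (d : nat) (A : set 'rV[R]_d)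
    (l : {scalar 'rV[R]_d}) (v : 'rV[R]_d) :
  A v -> (forall x, A x -> x = v \/ l x < l v) -> vertices (conv_hull A) v.
Proof.
move=> Av lA; split; first exact: sub_gen_smallest.
have lconv (x y : 'rV[R]_d) (t : R) :
  l (t *: x + (1 - t) *: y) = t * l x + (1 - t) * l y by rewrite linearD !linearZ.
have avg_ltl (a b c t : R) :
  0 < t -> t < 1 -> a < c -> b <= c -> t * a + (1 - t) * b < c by move=> *; nra.
have avg_ltr (a b c t : R) :
  0 < t -> t < 1 -> a <= c -> b < c -> t * a + (1 - t) * b < c by move=> *; nra.
have comb_id (x : 'rV[R]_d) (t : R) : t *: x + (1 - t) *: x = x.
  by rewrite -scalerDl addrC subrK scale1r.
have subC : (conv_hull A `<=` [set x | x = v \/ l x < l v])%classic.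
  apply: smallest_sub => //; apply/convex_setW => x y; rewrite !inE /=.
  move=> hx hy t t0 t1; rewrite inE /conv /= /isConvexSpace.conv /=.
  rewrite [l _](lconv x y t%:num).
  case: hx hy => [->|hx] [->|hy].
  - by left; apply: comb_id.
  - by right; apply: avg_ltr.
  - by right; apply: avg_ltl.
  - by right; apply: avg_ltl => //; apply: ltW.
move=> x y t /subC hx /subC hy t0 t1 e.
have := lconv x y t; rewrite -e.
case: hx hy => [->|hx] [->|hy] //; move/eqP; rewrite gt_eqF //.
- exact: avg_ltr.
- exact: avg_ltl.
- by apply: avg_ltl => //; apply: ltW.
Qed.

Lemma vertices_scale (R : realType) (d : nat) (K : set 'rV[R]_d) (c : R) v :
  c != 0 -> vertices K v -> vertices [set c *: x | x in K]%classic (c *: v).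
Proof.
move=> c0 [Kv ext]; split; first by exists v.
move=> _ _ t [x Kx <-] [y Ky <-] t0 t1 e.
have ve : v = t *: x + (1 - t) *: y.
  apply: (scalerI c0); rewrite e scalerDr !scalerA.
  by congr (_ *: _ + _ *: _); rewrite mulrC.
by have [-> ->] := ext x y t Kx Ky t0 t1 ve.
Qed.

(** * Points of D indexed by coordinate sets *)

(** The permutation sends each coordinate to its position in a list that enumerates S first and its
    complement afterwards. *)
Lemma perm_onto_set (d : nat) (S : {set 'I_d}) :
  exists p : 'S_d, forall i, (p i < #|S|)%N = (i \in S).
Proof.
pose L := enum S ++ enum (~: S).
have sizeL : size L = d.
  by rewrite size_cat -!cardE cardsC card_ord.
have memL i : i \in L by rewrite mem_cat !mem_enum inE orbN.
have ltL i : (index i L < d)%N by have := memL i; rewrite -index_mem sizeL.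
have injf : injective (fun i => Ordinal (ltL i)).
  by move=> i j [] /index_inj; apply.
exists (perm injf) => i; rewrite permE /= index_cat mem_enum.
case: ifP => iS; first by rewrite cardE index_mem mem_enum.
by rewrite cardE ltnNge leq_addr.
Qed.

Lemma exists_subset_card (T : finType) (A : {set T}) (n : nat) :
  (n <= #|A|)%N -> exists2 B : {set T}, B \subset A & #|B| = n.
Proof.
case/card_geqP => s [us ss sA]; exists [set x in s].
  by apply/fintype.subsetP => x; rewrite inE => /sA.
by rewrite cardsE (card_uniqP us).
Qed.

Definition indicator (R : realType) (d : nat) (S : {set 'I_d}) : 'rV[R]_d :=
  \row_i (i \in S)%:R.
Arguments indicator R {d} S.

(** Reading the shift off |S| makes one formula cover both families of [D_set], since |S| - 1 is s -
    1 or s. *)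
Definition D_point (R : realType) (k d : nat) (S : {set 'I_d}) : 'rV[R]_d :=
  indicator R S - ((#|S|%:R - 1) / (d%:R - 2 * k%:R)) *: const_mx 1.
Arguments D_point R k {d} S.

Lemma ones_perm (R : realType) (d : nat) (p : 'S_d) (n : nat) :
  col_perm p (ones R d n) = indicator R [set i | (p i < n)%N].
Proof. by apply/rowP => i; rewrite !mxE inE. Qed.

Lemma card_perm_lt (d : nat) (p : 'S_d) (n : nat) :
  (n <= d)%N -> #|[set i | (p i < n)%N]| = n.
Proof.
move=> nd; have -> : [set i | (p i < n)%N] = p @^-1: [set j : 'I_d | (j < n)%N].
  by apply/setP => i; rewrite !inE.
rewrite card_preimset; last exact: perm_inj.
have -> : [set j : 'I_d | (j < n)%N] = [set widen_ord nd i | i in [set: 'I_n]].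
  apply/setP => j; rewrite inE; apply/idP/imsetP => [jn|[i _ ->] //=].
  by exists (Ordinal jn) => //; apply: val_inj.
rewrite card_imset ?cardsT ?card_ord // => i j /(congr1 val) /= ij.
exact: val_inj.
Qed.

Lemma D_setP (R : realType) (s k d : nat) (x : 'rV[R]_d) : (s < d)%N ->
  D_set R s k d x <->
  exists2 S : {set 'I_d}, (#|S| == s) || (#|S| == s.+1) & x = D_point R k S.
Proof.
move=> sd; split.
  case=> -[p _ <-]; rewrite ones_perm.
    by exists [set i | (p i < s)%N]; rewrite /D_point card_perm_lt ?eqxx // ltnW.
  exists [set i | (p i < s.+1)%N]; rewrite /D_point card_perm_lt ?eqxx ?orbT //.
  by congr (_ - (_ / _) *: _); rewrite -[s.+1%:R]natr1 addrK.
case=> S /orP[]/eqP cS ->; have [p pS] := perm_onto_set _ S.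
  left; exists p => //; rewrite ones_perm /D_point cS; congr (indicator _ _ - _).
  by apply/setP => i; rewrite inE -pS cS.
right; exists p => //; rewrite ones_perm /D_point cS -[s.+1%:R]natr1 addrK.
by congr (indicator _ _ - _); apply/setP => i; rewrite inE -pS cS.
Qed.

(** * Linear functionals exposing the points of D and -D *)

Lemma sum_indicator (R : realType) (d : nat) (A S : {set 'I_d}) :
  \sum_(i in A) indicator R S 0 i = #|A :&: S|%:R.
Proof.
rewrite -sum1_card natr_sum big_mkcond [RHS]big_mkcond /=.
by apply: eq_bigr => i _; rewrite mxE !inE; case: (i \in A); case: (i \in S).
Qed.

Definition subset_functional (R : realType) (d : nat) (A : {set 'I_d}) (t : R)
  (x : 'rV[R]_d) : R := \sum_(i in A) x 0 i - t * \sum_i x 0 i.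

Fact subset_functional_is_scalar (R : realType) (d : nat) (A : {set 'I_d}) (t : R) :
  scalar (subset_functional R d A t).
Proof.
move=> c x y; rewrite /subset_functional.
under eq_bigr do rewrite !mxE.
under [X in _ - _ * X]eq_bigr do rewrite !mxE.
rewrite !big_split /= -!mulr_sumr; ring.
Qed.

HB.instance Definition _ (R : realType) d A t :=
  GRing.isLinear.Build R 'rV[R]_d R *%R (subset_functional R d A t)
    (subset_functional_is_scalar R d A t).

(** Here [e] collects all that multiplies |S| - 1: t from the term -t|S|, and the value |A| - td of
    the functional at j, divided by d - 2k. *)
Lemma subset_functional_point (R : realType) (k d : nat) (A S : {set 'I_d}) (t e : R) :
  t + (#|A|%:R - t * d%:R) / (d%:R - 2 * k%:R) = e ->
  subset_functional R d A t (D_point R k S) = #|A :&: S|%:R - (#|S|%:R - 1) * e - t.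
Proof.
move=> <-; rewrite /subset_functional /D_point.
have sumP (B : {set 'I_d}) (a : R) :
    \sum_(i in B) (indicator R S - a *: const_mx 1) 0 i = #|B :&: S|%:R - a * #|B|%:R.
  rewrite -sum_indicator -sum1_card natr_sum mulr_sumr -sumrB.
  by apply: eq_bigr => i _; rewrite !mxE.
rewrite sumP.
have -> : \sum_i (indicator R S - (#|S|%:R - 1) / (d%:R - 2 * k%:R) *: const_mx 1) 0 i
   = #|S|%:R - (#|S|%:R - 1) / (d%:R - 2 * k%:R) * d%:R.
  have := sumP [set: 'I_d]%SET ((#|S|%:R - 1) / (d%:R - 2 * k%:R)).
  rewrite finset.setTI cardsT card_ord => <-.
  by apply: eq_bigl => i; rewrite inE.
ring.
Qed.

Lemma point_vertex (R : realType) (s k d : nat) (S : {set 'I_d}) :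
  (1 <= s)%N -> (2 <= k)%N -> (k * (2 * s + 1) + 1 <= d)%N ->
  (#|S| == s) || (#|S| == s.+1) ->
  let K := conv_hull (D_set R s k d `|` [set - x | x in D_set R s k d])%classic in
  vertices K (D_point R k S) /\ vertices K (- D_point R k S).
Proof.
move=> hs hk hd cS.
have sd : (s < d)%N by nia.
have hN : 0 < d%:R - 2 * k%:R :> R.
  by rewrite subr_gt0 -natrM ltr_nat; nia.
(* The last two conditions say that the functional is smaller on the rest of D and on -D than at
   p_S. In the last one, the term -|S ∩ T| of the value at -p_T is bounded above by 0. *)
suff [t [e [et maxS maxN]]] : exists t e : R,
  [/\ t + (#|S|%:R - t * d%:R) / (d%:R - 2 * k%:R) = e,
    forall T : {set 'I_d}, (#|T| == s) || (#|T| == s.+1) -> T != S ->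
      #|S :&: T|%:R - (#|T|%:R - 1) * e - t < #|S|%:R - (#|S|%:R - 1) * e - t
  & forall T : {set 'I_d}, (#|T| == s) || (#|T| == s.+1) ->
      (#|T|%:R - 1) * e + t < #|S|%:R - (#|S|%:R - 1) * e - t].
  have DS : D_set R s k d (D_point R k S) by apply/D_setP => //; exists S.
  set A := (D_set R s k d `|` _)%classic.
  have AN x : A x -> A (- x).
    by case=> [Dx|[y Dy <-]]; [right; exists x|left; rewrite opprK].
  suff maxA x : A x ->
      x = D_point R k S \/
      subset_functional R d S t x < subset_functional R d S t (D_point R k S).
    split.
      by apply: (vertex_of_strict_max _ _ _ (subset_functional R d S t)) => //; left.
    (* As D together with -D is symmetric, the opposite functional exposes -p_S. *)
    apply: (vertex_of_strict_max _ _ _ (subset_functional R d S t \o -%R)).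
      by apply: AN; left.
    move=> x /AN /maxA /=; rewrite opprK => -[<-|]; [left|by right].
    by rewrite opprK.
  move=> [/D_setP|[y /D_setP]].
    case=> // T cT ->; have [->|neTS] := eqVneq T S; [by left|right].
    by rewrite /= !(subset_functional_point _ _ _ _ _ _ _ et) finset.setIid maxS.
  case=> // T cT -> <-; right.
  rewrite linearN /= !(subset_functional_point _ _ _ _ _ _ _ et) finset.setIid.
  apply: le_lt_trans (maxN T cT).
  by rewrite !opprB; have : 0 <= #|S :&: T|%:R :> R by []; lra.
have hk' : 2 <= k%:R :> R by rewrite ler_nat.
have hs' : 1 <= s%:R :> R by rewrite ler1n.
have capS (T : {set 'I_d}) : (#|S :&: T|%:R <= #|S|%:R :> R).
  by rewrite ler_nat subset_leq_card // finset.subsetIl.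
have cap_lt (T : {set 'I_d}) : (#|T| <= #|S|)%N -> T != S ->
    #|S :&: T|%:R + 1 <= #|S|%:R :> R.
  move=> cTS neTS; rewrite natr1 ler_nat ltnNge; apply/negP => cST.
  case/eqP: neTS; apply/eqP; rewrite eq_sym eqEcard cTS andbT.
  by apply/finset.setIidPl/eqP; rewrite eqEcard finset.subsetIl.
case/orP: cS => /eqP cS.
  pose g : R := (d%:R - 2 * k%:R)^-1.
  have g0 : 0 < g by rewrite invr_gt0.
  (* The bound on d gives d - 2k >= k(2s - 1) + 1 > 2(2s - 1). This controls the terms in g when p_S
     is compared with -D. *)
  have gsmall : 2 * (2 * s%:R - 1) * g < 1.
    rewrite ltr_pdivrMr // mul1r.
    have : (k * (2 * s + 1) + 1)%:R <= d%:R :> R by rewrite ler_nat.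
    by rewrite !(natrD, natrM); nra.
  have t_small : 4 * ((s%:R - 1) / (2 * k%:R)) <= s%:R - 1 :> R.
    by rewrite mulrA ler_pdivrMr; nra.
  (* t = s / (2k) would give e = 0 and a tie with the supersets of S;
     this slightly smaller t gives e = g > 0. *)
  exists ((s%:R - 1) / (2 * k%:R)), g; rewrite cS; split.
  - by rewrite /g; field; rewrite !gt_eqF //; lra.
  - move=> T cT neTS; case/orP: cT => /eqP cT; rewrite cT.
      by have := cap_lt T; rewrite cT cS => /(_ (leqnn _) neTS); lra.
    by have := capS T; rewrite cS -[s.+1%:R]natr1; nra.
  - by move=> T /orP[]/eqP ->; rewrite -?[s.+1%:R]natr1; nra.
(* Now |S| = s + 1, and no admissible T strictly contains S. So t = |S| / (2k), which makes e = 0,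
   produces no tie. *)
have t_small : 4 * ((s%:R + 1) / (2 * k%:R)) <= s%:R + 1 :> R.
  by rewrite mulrA ler_pdivrMr; nra.
exists ((s%:R + 1) / (2 * k%:R)), 0; rewrite cS -natr1; split.
- by field; rewrite !gt_eqF //; lra.
- move=> T cT neTS; have := cap_lt T; rewrite cS => /(_ _ neTS).
  have -> : (#|T| <= s.+1)%N by case/orP: cT => /eqP ->.
  by rewrite -natr1 => /(_ isT); lra.
- by move=> T _; rewrite !mulr0; move: t_small; set t := _ / _; lra.
Qed.

(** * Symmetric bilinear forms: differences and coordinates *)

Definition form_sub (R : realType) (U : lmodType R) (b1 b2 : {symmetric U})
  (x y : U) : R := b1 x y - b2 x y.

Fact form_sub_bilinear (R : realType) (U : lmodType R) (b1 b2 : {symmetric U}) :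
  bilinear_for *%R *%R (form_sub R U b1 b2).
Proof.
split=> z a x y; rewrite /form_sub.
  by rewrite !linearPl /=; ring.
by rewrite !linearPr /=; ring.
Qed.

(** A symmetric form is encoded as a Hermitian one with sign [false] and conjugation [idfun], hence
    the shape of the right-hand side. *)
Fact form_sub_symmetric (R : realType) (U : lmodType R) (b1 b2 : {symmetric U})
    (x y : U) :
  form_sub R U b1 b2 x y = (-1) ^+ false * idfun (form_sub R U b1 b2 y x).
Proof. by rewrite /form_sub hermC [b2 x y]hermC /= !mul1r. Qed.

HB.instance Definition _ (R : realType) (U : lmodType R) (b1 b2 : {symmetric U}) :=
  bilinear_isBilinear.Build R U U R *%R *%R (form_sub R U b1 b2)
    (form_sub_bilinear R U b1 b2).
HB.instance Definition _ (R : realType) (U : lmodType R) (b1 b2 : {symmetric U}) :=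
  isHermitianSesquilinear.Build R U false idfun (form_sub R U b1 b2)
    (form_sub_symmetric R U b1 b2).

Section SymmetricForm.
Context {R : realType} {d : nat} (b : {symmetric 'rV[R]_d}).

Lemma symmetricC x y : b x y = b y x.
Proof. by rewrite hermC /= mul1r. Qed.

Lemma form_sub_squares x y : b x x - b y y = b (x - y) (x + y).
Proof. by rewrite linearBl !linearDr /= (symmetricC y x); ring. Qed.

Lemma form_coord x y : b x y = \sum_i x 0 i * b (delta_mx 0 i) y.
Proof.
rewrite {1}[x]row_sum_delta linear_sumlz.
by apply: eq_bigr => i _; rewrite linearZl_LR.
Qed.

Lemma form_coordr x y : b x y = \sum_i y 0 i * b x (delta_mx 0 i).
Proof. by rewrite symmetricC form_coord; under eq_bigr do rewrite symmetricC. Qed.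

Lemma form_indicator x (K : {set 'I_d}) :
  b x (indicator R K) = \sum_(i in K) b x (delta_mx 0 i).
Proof.
rewrite form_coordr [RHS]big_mkcond; apply: eq_bigr => i _.
by rewrite mxE; case: (i \in K); rewrite ?mul1r ?mul0r.
Qed.

Lemma form_ones x : b x (const_mx 1) = \sum_i b x (delta_mx 0 i).
Proof. by rewrite form_coordr; under eq_bigr do rewrite mxE mul1r. Qed.

End SymmetricForm.

(** * Exchanging one coordinate of S for another *)

Lemma pointU1 (R : realType) (k d : nat) (a : 'I_d) (K : {set 'I_d}) : a \notin K ->
  D_point R k (a |: K) = indicator R K + delta_mx 0 a
    - (#|K|%:R / (d%:R - 2 * k%:R)) *: const_mx 1.
Proof.
move=> aK; rewrite /D_point cardsU1 aK add1n -natr1 addrK; congr (_ - _).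
apply/rowP => i; rewrite !mxE !inE eqxx /=.
by have [->|] := eqVneq i a; rewrite ?(negPf aK) ?add0r ?addr0.
Qed.

Section SwapRelations.
Context {R : realType} (s k d : nat) (b : {symmetric 'rV[R]_d}).
Context (hs : (1 <= s)%N).
Context (hk : (2 <= k)%N).
Context (hd : (k * (2 * s + 1) + 1 <= d)%N).
Context (hb : forall S : {set 'I_d}, (#|S| == s) || (#|S| == s.+1) ->
  b (D_point R k S) (D_point R k S) = 0).
Let g : R := (d%:R - 2 * k%:R)^-1.
Let e (i : 'I_d) : 'rV[R]_d := delta_mx 0 i.
Context (a c : 'I_d).
Context (neac : a != c).
Let f := b (e a - e c).

(** The form vanishes at the points of a |: K and c |: K, whose difference is e_a - e_c; the
    difference of squares gives the relation. The common shift |K| g is spread over the |K| terms of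
    the sum. *)
Let relK (K : {set 'I_d}) : a \notin K -> c \notin K ->
    (#|K|.+1 == s) || (#|K|.+1 == s.+1) ->
  2 * \sum_(i in K) (f (e i) - g * f (const_mx 1)) + f (e a + e c) = 0.
Proof.
move=> aK cK cardK.
have Qa : b (D_point R k (a |: K)) (D_point R k (a |: K)) = 0.
  by apply: hb; rewrite cardsU1 aK.
have Qc : b (D_point R k (c |: K)) (D_point R k (c |: K)) = 0.
  by apply: hb; rewrite cardsU1 cK.
have := form_sub_squares b (D_point R k (a |: K)) (D_point R k (c |: K)).
rewrite Qa Qc subrr !pointU1 //.
set J := const_mx 1; set h := _ / _.
have -> : indicator R K + delta_mx 0 a - h *: J - (indicator R K + delta_mx 0 c - h *: J)
  = e a - e c.
  by apply/rowP => i; rewrite !mxE; ring.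
have -> : indicator R K + delta_mx 0 a - h *: J + (indicator R K + delta_mx 0 c - h *: J)
  = 2 *: (indicator R K - h *: J) + (e a + e c).
  by apply/rowP => i; rewrite !mxE; ring.
rewrite linearDr linearZr_LR /= linearBr linearZr_LR /= form_indicator /= -/f => rel.
by rewrite [RHS]rel sumrB sumr_const /h -/g -[g * f J *+ _]mulr_natl !mulrA.
Qed.

Let relE (i : 'I_d) : i != a -> i != c -> f (e i) = g * f (const_mx 1).
Proof.
move=> ia ic.
(* Take K of size s - 1 avoiding a, c and i. Subtracting [relK] for K from [relK] for i |: K leaves
   only the term of i. *)
have [] := @exists_subset_card _ (~: [set a; c; i]) s.-1.
  have := cardsC [set a; c; i]; rewrite card_ord.
  have : (#|[set a; c; i]| <= 3)%N.
    by rewrite -!finset.setUA !cardsU1 cards1; lia.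
  by nia.
move=> K /fintype.subsetP sK cK.
have out x : x \in [set a; c; i] -> x \notin K.
  by move=> xA; apply/negP => /sK; rewrite inE xA.
have aK : a \notin K by apply: out; rewrite !inE eqxx.
have cK' : c \notin K by apply: out; rewrite !inE eqxx orbT.
have iK : i \notin K by apply: out; rewrite !inE eqxx orbT.
have rel1 : _ := relK K aK cK' _.
have rel2 : _ := relK (i |: K) _ _ _.
move: rel1 rel2; rewrite big_setU1 //= cardsU1 iK cK !inE.
rewrite (negPf aK) (negPf cK') ![_ == i]eq_sym (negPf ia) (negPf ic) /=.
rewrite add1n prednK // !eqxx orbT => /(_ isT) rel1 /(_ isT isT isT) rel2.
lra.
Qed.

Lemma swap_diag : f (e a + e c) = 0.
Proof.
have [] := @exists_subset_card _ (~: [set a; c]) s.-1.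
  have := cardsC [set a; c]; rewrite card_ord cards2 neac.
  by nia.
move=> K /fintype.subsetP sK cK.
have out x : x \in [set a; c] -> x \notin K.
  by move=> xA; apply/negP => /sK; rewrite inE xA.
have aK : a \notin K by apply: out; rewrite !inE eqxx.
have cK' : c \notin K by apply: out; rewrite !inE eqxx orbT.
have := relK K aK cK'; rewrite cK prednK // eqxx => /(_ isT).
(* By [relE] every term of the sum in [relK] vanishes, so only f(e_a + e_c) remains. *)
rewrite big1 ?mulr0 ?add0r // => i iK; rewrite relE ?subrr //.
  by apply: contraNneq aK => <-.
by apply: contraNneq cK' => <-.
Qed.

Lemma swap_offdiag (i : 'I_d) : i != a -> i != c -> f (e i) = 0.
Proof.
move=> ia ic; rewrite relE //.
suff -> : f (const_mx 1) = 0 by rewrite mulr0.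
have hk' : 2 <= k%:R :> R by rewrite ler_nat.
have hN : 0 < d%:R - 2 * k%:R :> R.
  by rewrite subr_gt0 -natrM ltr_nat; nia.
(* Summing f over all coordinates, those of a and c cancel by [swap_diag] and the other d - 2 are
   equal. The resulting factor 1 - (d - 2)g = 2(1 - k)g is nonzero because k >= 2. *)
have : f (const_mx 1) = (d%:R - 2) * (g * f (const_mx 1)).
  rewrite {1}/f form_ones (bigD1 a) //= (bigD1 c) 1?eq_sym //= -/f addrA.
  have -> : f (delta_mx 0 a) + f (delta_mx 0 c) = 0.
    by rewrite -swap_diag /f linearDr.
  rewrite add0r (eq_bigr (fun=> g * f (const_mx 1))); last first.
    by move=> j /andP[ja jc]; apply: relE.
  rewrite sumr_const -[g * _ *+ _]mulr_natl; congr (_ * _).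
  have := cardsC [set a; c]; rewrite cards2 neac card_ord => dE.
  rewrite -[X in X%:R - _]dE natrD addrAC subrr add0r; congr (_%:R).
  by apply: eq_card => j; rewrite !inE negb_or.
move/eqP; rewrite -subr_eq0 mulrA -{1}[f _]mul1r -mulrBl mulf_eq0.
case/orP => /eqP // h0; exfalso; move: h0; apply/eqP.
have -> : 1 - (d%:R - 2) * g = 2 * (1 - k%:R) * g.
  by rewrite /g; field; rewrite gt_eqF.
by rewrite !mulf_neq0 ?invr_eq0 ?(gt_eqF hN) ?pnatr_eq0 // lt_eqF //; lra.
Qed.

End SwapRelations.

(** * Forms vanishing on D *)

(** The exchange relations make the matrix of b constant on the diagonal and constant off it; u is
    the off-diagonal entry and v the difference of the two. *)
Lemma vanishing_form_shape (R : realType) (s k d : nat) (b : {symmetric 'rV[R]_d}) :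
  (1 <= s)%N -> (2 <= k)%N -> (k * (2 * s + 1) + 1 <= d)%N ->
  (forall S : {set 'I_d}, (#|S| == s) || (#|S| == s.+1) ->
    b (D_point R k S) (D_point R k S) = 0) ->
  exists u v : R, forall x,
    b x x = u * (\sum_i x 0 i) ^+ 2 + v * \sum_i x 0 i ^+ 2.
Proof.
move=> hs hk hd hb.
pose B i j := b (delta_mx 0 i) (delta_mx 0 j).
have BC i j : B i j = B j i by apply: symmetricC.
have Bdiag i j : B i i = B j j.
  have [->//|nij] := eqVneq i j.
  have := swap_diag s k d b hs hk hd hb i j nij.
  rewrite linearBl !linearDr /= -!/(B _ _) (BC j i); lra.
have Boff i j l : i != l -> j != l -> B i l = B j l.
  move=> il jl; have [->//|nij] := eqVneq i j.
  have := swap_offdiag s k d b hs hk hd hb i j nij l.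
  rewrite linearBl -!/(B _ _) ![l == _]eq_sym => /(_ il jl); lra.
have d0 : (0 < d)%N by nia.
have d1 : (1 < d)%N by nia.
pose i0 := Ordinal d0; pose i1 := Ordinal d1.
have Bij i j : i != j -> B i j = B i0 i1.
  have i01 : i0 != i1 by [].
  (* [Boff] only changes the first index, so for i other than i1 the path is (j, i), (i1, i), (i,
     i1), (i0, i1), with a transposition in the middle. *)
  move=> nij; rewrite BC; have [i1i|ni1] := eqVneq i i1.
    by rewrite i1i; apply: Boff; rewrite // eq_sym -i1i.
  by rewrite (Boff j i1) 1?eq_sym // BC; apply: Boff.
exists (B i0 i1), (B i0 i0 - B i0 i1) => x.
have BE i j : B i j = B i0 i1 + (i == j)%:R * (B i0 i0 - B i0 i1).
  have [->|nij] := eqVneq i j; first by rewrite (Bdiag j i0) mul1r addrC subrK.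
  by rewrite Bij // mul0r addr0.
rewrite form_coord.
transitivity (\sum_i (B i0 i1 * (\sum_j x 0 j) * x 0 i
    + (B i0 i0 - B i0 i1) * x 0 i ^+ 2)).
  apply: eq_bigr => i _; rewrite form_coordr.
  have -> : \sum_j x 0 j * b (delta_mx 0 i) (delta_mx 0 j)
    = B i0 i1 * \sum_j x 0 j + (B i0 i0 - B i0 i1) * x 0 i.
    have -> : x 0 i = \sum_j (i == j)%:R * x 0 j.
      rewrite (bigD1 i) //= eqxx mul1r big1 ?addr0 // => j; rewrite eq_sym.
      by move/negPf ->; rewrite mul0r.
    rewrite !mulr_sumr -big_split; apply: eq_bigr => j _ /=.
    by rewrite -/(B i j) (BE i j); set z := (i == j)%:R; ring.
  by ring.
by rewrite big_split /= -!mulr_sumr -mulrA expr2.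
Qed.

Lemma sum_mem (R : realType) (T : finType) (S : {set T}) :
  \sum_i (i \in S)%:R = #|S|%:R :> R.
Proof.
rewrite -sum1_card natr_sum [RHS]big_mkcond /=.
by apply: eq_bigr => i _; case: (i \in S).
Qed.

Lemma sum_D_point (R : realType) (k d : nat) (S : {set 'I_d}) (h : R) :
  (#|S|%:R - 1) / (d%:R - 2 * k%:R) = h ->
  \sum_i D_point R k S 0 i = #|S|%:R - d%:R * h.
Proof.
move=> hE; rewrite /D_point hE.
under eq_bigr do rewrite !mxE mulr1.
by rewrite sumrB sumr_const card_ord -[h *+ d]mulr_natl sum_mem.
Qed.

Lemma sum_sqr_D_point (R : realType) (k d : nat) (S : {set 'I_d}) (h : R) :
  (#|S|%:R - 1) / (d%:R - 2 * k%:R) = h ->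
  \sum_i D_point R k S 0 i ^+ 2 = #|S|%:R * (1 - 2 * h) + d%:R * h ^+ 2.
Proof.
move=> hE; rewrite /D_point hE.
rewrite (eq_bigr (fun i => (i \in S)%:R * (1 - 2 * h) + h ^+ 2)); last first.
  by move=> i _; rewrite !mxE; case: (i \in S) => /=; ring.
by rewrite big_split /= -mulr_suml sumr_const card_ord -[_ *+ d]mulr_natl sum_mem.
Qed.

Lemma vanishing_form_eq0 (R : realType) (s k d : nat) (b : {symmetric 'rV[R]_d}) :
  (1 <= s)%N -> (2 <= k)%N -> (k * (2 * s + 1) + 1 <= d)%N ->
  (forall S : {set 'I_d}, (#|S| == s) || (#|S| == s.+1) ->
    b (D_point R k S) (D_point R k S) = 0) ->
  forall x, b x x = 0.
Proof.
move=> hs hk hd hb.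
have [u [v bE]] := vanishing_form_shape R s k d b hs hk hd hb.
have bn n : (n == s) || (n == s.+1) ->
    let h := (n%:R - 1) / (d%:R - 2 * k%:R) in
    u * (n%:R - d%:R * h) ^+ 2 + v * (n%:R * (1 - 2 * h) + d%:R * h ^+ 2) = 0.
  move=> ns h; have [] := @exists_subset_card _ [set: 'I_d] n.
    by rewrite cardsT card_ord; case/orP: ns => /eqP ->; nia.
  move=> S _ cS; have := hb S; rewrite cS => /(_ ns).
  rewrite bE (sum_D_point _ _ _ _ h) ?(sum_sqr_D_point _ _ _ _ h) cS //.
have := bn s; have := bn s.+1; rewrite !eqxx orbT => /(_ isT) /= E2 /(_ isT) /= E1.
have hN : d%:R - 2 * k%:R != 0 :> R.
  by rewrite gt_eqF // subr_gt0 -natrM ltr_nat; nia.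
(* From d > k(2s + 1) and d - 2s - 1 > (k - 1)(2s + 1), the product d(d - 2s - 1) exceeds k(k -
   1)(2s + 1)^2, and (2s + 1)^2 = 4s(s + 1) + 1. *)
have F0 : 4 * k%:R * (k%:R - 1) * s%:R * (s%:R + 1) - d%:R * (d%:R - 2 * s%:R - 1) != 0 :> R.
  rewrite lt_eqF // subr_lt0.
  have k1 : k%:R - 1 = k.-1%:R :> R by rewrite -subn1 natrB // ltnW.
  have d1 : d%:R - 2 * s%:R - 1 = (d - 2 * s - 1)%:R :> R.
    by rewrite !natrB ?natrM //; nia.
  rewrite k1 d1 natr1 -!natrM ltr_nat; nia.
move: E1 E2; rewrite -[s.+1%:R]natr1 addrK.
set p1 := (s%:R - _) ^+ 2; set r1 := (s%:R * _ + _).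
set p2 := (s%:R + 1 - _) ^+ 2; set r2 := ((s%:R + 1) * _ + _) => E1 E2.
have det0 : p2 * r1 - p1 * r2 != 0.
  have -> : p2 * r1 - p1 * r2 =
    (4 * k%:R * (k%:R - 1) * s%:R * (s%:R + 1) - d%:R * (d%:R - 2 * s%:R - 1))
    / (d%:R - 2 * k%:R) ^+ 2 by rewrite /p1 /p2 /r1 /r2; field.
  by rewrite mulf_neq0 // invr_eq0 expf_neq0.
(* Cramer's rule for the homogeneous system with rows (p1, r1) and (p2, r2). *)
have u0 : u = 0.
  apply: (mulIf det0); rewrite mul0r.
  have -> : u * (p2 * r1 - p1 * r2) = (u * p2 + v * r2) * r1 - (u * p1 + v * r1) * r2 by ring.
  by rewrite E1 E2 !mul0r subrr.
have v0 : v = 0.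
  apply: (mulIf det0); rewrite mul0r.
  have -> : v * (p2 * r1 - p1 * r2) = (u * p1 + v * r1) * p2 - (u * p2 + v * r2) * p1 by ring.
  by rewrite E1 E2 !mul0r subrr.
by move=> x; rewrite bE u0 v0 !mul0r addr0.
Qed.

(** * The centre of the ellipsoid and uniqueness of the form *)

(** Let L = b(c, j). Comparing S with i |: S gives b(c, e_i) = gL for every i. Summing over i gives
    L = dgL, that is 2kgL = 0, so L = 0 and every coordinate vanishes. *)
Lemma D_point_radical (R : realType) (s k d : nat) (b : {symmetric 'rV[R]_d})
    (c : 'rV[R]_d) :
  (1 <= s)%N -> (2 <= k)%N -> (k * (2 * s + 1) + 1 <= d)%N ->
  (forall S : {set 'I_d}, (#|S| == s) || (#|S| == s.+1) -> b c (D_point R k S) = 0) ->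
  forall x, b c x = 0.
Proof.
move=> hs hk hd hb.
have hN : d%:R - 2 * k%:R != 0 :> R.
  by rewrite gt_eqF // subr_gt0 -natrM ltr_nat; nia.
pose g : R := (d%:R - 2 * k%:R)^-1.
pose L := b c (const_mx 1).
have rel (S : {set 'I_d}) : (#|S| == s) || (#|S| == s.+1) ->
    \sum_(i in S) b c (delta_mx 0 i) = (#|S|%:R - 1) * g * L.
  move=> cS; have := hb S cS; rewrite /D_point linearBr linearZr_LR /=.
  rewrite form_indicator -/L => /eqP.
  by rewrite subr_eq0 => /eqP.
have coord i : b c (delta_mx 0 i) = g * L.
  have [] := @exists_subset_card _ (~: [set i]) s.
    by have := cardsC [set i]; rewrite card_ord cards1; nia.
  move=> S /fintype.subsetP sS cS.
  have iS : i \notin S by apply/negP => /sS; rewrite !inE eqxx.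
  have := rel S; have := rel (i |: S); rewrite big_setU1 // cardsU1 iS cS.
  rewrite add1n !eqxx orbT -natr1 => /(_ isT) /= h1 /(_ isT) h2.
  by move: h1; rewrite h2; lra.
have L0 : L = 0.
  have LE : L = d%:R * (g * L).
    rewrite {1}/L form_ones (eq_bigr (fun=> g * L)) // sumr_const card_ord.
    by rewrite mulr_natl.
  have k0 : 2 * k%:R * g != 0.
    by rewrite !mulf_neq0 ?invr_eq0 ?pnatr_eq0 //; lia.
  apply: (mulfI k0); rewrite mulr0.
  have -> : 2 * k%:R * g * L = d%:R * (g * L) - L by rewrite /g; field.
  by rewrite -LE subrr.
move=> x; rewrite form_coordr big1 // => i _.
by rewrite coord L0 !mulr0.
Qed.

(** The equations at p_S/2 and -p_S/2 differ only in the sign of b(c, p_S), which is therefore 0.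
    Then c lies in the radical of b, so b(c, c) = 0; the value 4 undoes the factor 1/2 in
    [P_set]. *)
Lemma ellipsoid_through_vertices (R : realType) (s k d : nat)
    (b : {symmetric 'rV[R]_d}) (phi : 'rV[R]_d -> R) (c : 'rV[R]_d) :
  (1 <= s)%N -> (2 <= k)%N -> (k * (2 * s + 1) + 1 <= d)%N ->
  (forall x, phi x = b x x) ->
  (vertices (P_set R s k d) `<=` ellipsoid phi c)%classic ->
  forall S : {set 'I_d}, (#|S| == s) || (#|S| == s.+1) ->
    b (D_point R k S) (D_point R k S) = 4.
Proof.
move=> hs hk hd phiE sub.
have half0 : 2^-1 != 0 :> R by rewrite invr_eq0 pnatr_eq0.
have bexp (e : R) x : b (e *: x - c) (e *: x - c) = e ^+ 2 * b x x - 2 * e * b c x + b c c.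
  rewrite linearBl !linearBr /= !linearZl_LR /= !linearZr_LR /= (symmetricC b x c).
  ring.
have vtx (S : {set 'I_d}) : (#|S| == s) || (#|S| == s.+1) ->
    b (D_point R k S) (D_point R k S) / 4 + b c c = 1 /\ b c (D_point R k S) = 0.
  move=> cS; have [vp vn] := point_vertex R s k d S hs hk hd cS.
  have := sub _ (vertices_scale _ _ _ _ _ half0 vp).
  have := sub _ (vertices_scale _ _ _ _ _ half0 vn).
  rewrite /ellipsoid /= !phiE scalerN -scaleNr !bexp => e1 e2.
  by split; lra.
have c0 := D_point_radical R s k d b c hs hk hd (fun S cS => (vtx S cS).2).
by move=> S /vtx [+ _]; rewrite c0; lra.
Qed.

Local Open Scope classical_set_scope.

Theorem theorem9 (R : realType) (s k d : nat)
    (hs : (1 <= s)%N) (hk : (2 <= k)%N) (hd : (k * (2 * s + 1) + 1 <= d)%N) :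
  is_subset1 [set phi : 'rV[R]_d -> R |
    [/\ quadratic_form phi, positive_definite phi
      & exists c : 'rV[R]_d, vertices (P_set R s k d) `<=` ellipsoid phi c]].
Proof.
move=> phi1 phi2 [[b1 phi1E] _ [c1 sub1]] [[b2 phi2E] _ [c2 sub2]].
apply/funext => x; rewrite phi1E phi2E; apply/eqP; rewrite -subr_eq0; apply/eqP.
(* Whatever the two centres are, both forms take the value 4 at each p_S, so their difference
   vanishes on D. *)
apply: (vanishing_form_eq0 R s k d (form_sub R _ b1 b2) hs hk hd) => S cS.
have e1 := ellipsoid_through_vertices R s k d b1 phi1 c1 hs hk hd phi1E sub1 S cS.
have e2 := ellipsoid_through_vertices R s k d b2 phi2 c2 hs hk hd phi2E sub2 S cS.
by rewrite /= /form_sub e1 e2 subrr.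
Qed.
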